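(* Let $\mathcal{V}$ be a variety of groups such that every group in $\mathcal{V}$ is amenable and every relatively free group of $\mathcal{V}$ is right orderable. Then there exists a function $f\colon\mathbb{N}\to\mathbb{N}$, depending only on $\mathcal{V}$, with the following property: whenever $G$ is a non-amenable group and $H$ is a normal subgroup of $G$ with $G/H\in\mathcal{V}$, we have $\mathcal{T}(H)\leq f(\mathcal{T}(G))$.
   Context: A group $G$ admits a paradoxical decomposition if there exist positive integers $m,n$, pairwise disjoint subsets $P_1,\ldots,P_m,Q_1,\ldots,Q_n$ of $G$ and elements $g_1,\ldots,g_m,h_1,\ldots,h_n\in G$ such that $G=\bigcup_{i=1}^m P_ig_i=\bigcup_{j=1}^n Q_jh_j$; this happens if and only if $G$ is non-amenable. For a non-amenable group $G$, the Tarski number $\mathcal{T}(G)$ is the minimal value of $m+n$ over all paradoxical decompositions of $G$. A group is right orderable if it admits a total order invariant under right multiplication. *)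

(* Defs.v *)
From Stdlib Require Import Reals ProofIrrelevance.
Open Scope R_scope.

Record group := Group {
  carrier :> Type;
  gmul : carrier -> carrier -> carrier;
  gone : carrier;
  ginv : carrier -> carrier;
  gmulA : forall a b c, gmul (gmul a b) c = gmul a (gmul b c);
  gmul1 : forall a, gmul gone a = a;
  gmulV : forall a, gmul (ginv a) a = gone
}.
Arguments gmul {g}.
Arguments gone {g}.
Arguments ginv {g}.

Definition is_hom (G K : group) (phi : G -> K) : Prop :=
  forall a b : G, phi (gmul a b) = gmul (phi a) (phi b).

(** Group words in the variables x_0, x_1, ... (elements of the free group
    of countable rank, represented by terms) and their evaluation. *)
Inductive word :=
| WVar : nat -> word
| WOne : word
| WMul : word -> word -> word
| WInv : word -> word.

Fixpoint eval (G : group) (s : nat -> G) (w : word) : G :=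
  match w with
  | WVar n => s n
  | WOne => gone
  | WMul u v => gmul (eval G s u) (eval G s v)
  | WInv u => ginv (eval G s u)
  end.

Definition variety := word -> Prop.

Definition in_variety (V : variety) (G : group) : Prop :=
  forall w, V w -> forall s : nat -> G, eval G s w = gone.

Definition relatively_free (V : variety) (F : group) : Prop :=
  in_variety V F /\
  exists (X : Type) (iota : X -> F),
    forall (K : group), in_variety V K ->
      forall t : X -> K,
        exists psi : F -> K,
          is_hom F K psi /\ (forall x, psi (iota x) = t x) /\
          forall psi' : F -> K, is_hom F K psi' ->
            (forall x, psi' (iota x) = t x) -> forall y, psi' y = psi y.

Definition right_orderable (G : group) : Prop :=
  exists le : G -> G -> Prop,
    (forall a, le a a) /\
    (forall a b, le a b -> le b a -> a = b) /\
    (forall a b c, le a b -> le b c -> le a c) /\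
    (forall a b, le a b \/ le b a) /\
    (forall a b c, le a b -> le (gmul a c) (gmul b c)).

Definition rtrans (G : group) (A : G -> Prop) (g : G) : G -> Prop :=
  fun x => exists a, A a /\ x = gmul a g.

Definition amenable (G : group) : Prop :=
  exists mu : (G -> Prop) -> R,
    mu (fun _ => True) = 1 /\
    (forall A, 0 <= mu A) /\
    (forall A B : G -> Prop, (forall x, A x -> B x -> False) ->
       mu (fun x => A x \/ B x) = mu A + mu B) /\
    (forall A g, mu (rtrans G A g) = mu A).

Definition paradoxical_with (G : group) (N : nat) : Prop :=
  exists (m n : nat) (P Q : nat -> G -> Prop) (g h : nat -> G),
    (0 < m)%nat /\ (0 < n)%nat /\ (m + n)%nat = N /\
    (forall i i' x, (i < m)%nat -> (i' < m)%nat -> i <> i' -> P i x -> P i' x -> False) /\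
    (forall j j' x, (j < n)%nat -> (j' < n)%nat -> j <> j' -> Q j x -> Q j' x -> False) /\
    (forall i j x, (i < m)%nat -> (j < n)%nat -> P i x -> Q j x -> False) /\
    (forall x : G, exists i, (i < m)%nat /\ rtrans G (P i) (g i) x) /\
    (forall x : G, exists j, (j < n)%nat /\ rtrans G (Q j) (h j) x).

Definition tarski_number (G : group) (k : nat) : Prop :=
  paradoxical_with G k /\ forall N, paradoxical_with G N -> (k <= N)%nat.

Lemma gmulVr (H : group) (x : H) : gmul x (ginv x) = gone.
Proof.
  transitivity (gmul (gmul (ginv (ginv x)) (ginv x)) (gmul x (ginv x))).
  { rewrite gmulV, gmul1. reflexivity. }
  rewrite gmulA, <- (gmulA H (ginv x) x (ginv x)), (gmulV H x), gmul1.
  apply gmulV.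
Qed.

Lemma gmulr1 (H : group) (x : H) : gmul x gone = x.
Proof. rewrite <- (gmulV H x), <- gmulA, gmulVr, gmul1. reflexivity. Qed.

Section Kernel.
Variables (G K : group) (phi : G -> K) (hphi : is_hom G K phi).

Lemma hom_one : phi gone = gone.
Proof.
  assert (E : gmul (phi gone) (phi gone) = phi gone).
  { rewrite <- hphi, gmul1. reflexivity. }
  assert (E2 : gmul (ginv (phi gone)) (gmul (phi gone) (phi gone))
             = gmul (ginv (phi gone)) (phi gone)) by (rewrite E; reflexivity).
  rewrite <- gmulA, gmulV, gmul1 in E2. exact E2.
Qed.

Lemma hom_inv a : phi (ginv a) = ginv (phi a).
Proof.
  assert (E : gmul (phi (ginv a)) (phi a) = gone).
  { rewrite <- hphi, gmulV. apply hom_one. }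
  assert (Rv : forall (H : group) (x : H), gmul x (ginv x) = gone).
  { intros H x.
    transitivity (gmul (gmul (ginv (ginv x)) (ginv x)) (gmul x (ginv x))).
    { rewrite gmulV, gmul1. reflexivity. }
    rewrite gmulA, <- (gmulA H (ginv x) x (ginv x)), (gmulV H x), gmul1.
    apply gmulV. }
  assert (E2 : gmul (gmul (phi (ginv a)) (phi a)) (ginv (phi a))
             = gmul gone (ginv (phi a))) by (rewrite E; reflexivity).
  rewrite gmulA, Rv in E2.
  rewrite gmul1 in E2.
  assert (R1 : forall (H : group) (x : H), gmul x gone = x).
  { intros H x. rewrite <- (gmulV H x), <- gmulA, Rv, gmul1. reflexivity. }
  rewrite R1 in E2. exact E2.
Qed.

Definition ker_carrier := { x : G | phi x = gone }.

Definition ker_mul (a b : ker_carrier) : ker_carrier.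
Proof.
  exists (gmul (proj1_sig a) (proj1_sig b)).
  rewrite hphi, (proj2_sig a), (proj2_sig b), gmul1. reflexivity.
Defined.

Definition ker_one : ker_carrier := exist _ gone hom_one.

Definition ker_inv (a : ker_carrier) : ker_carrier.
Proof.
  exists (ginv (proj1_sig a)).
  rewrite hom_inv, (proj2_sig a).
  rewrite <- (gmul1 K (ginv gone)). apply gmulVr.
Defined.

Lemma ker_eq (a b : ker_carrier) : proj1_sig a = proj1_sig b -> a = b.
Proof.
  destruct a as [a pa], b as [b pb]; simpl; intros ->.
  f_equal; apply proof_irrelevance.
Qed.

Definition ker_group : group.
Proof.
  refine (@Group ker_carrier ker_mul ker_one ker_inv _ _ _);
  intros; apply ker_eq; simpl; auto using gmulA, gmul1, gmulV.
Defined.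
End Kernel.

(* Main.v *)
(** A paradoxical decomposition of a group is, by Hall's theorem, the same as an injection of
    two copies of the group into itself moving points by finitely many right translations, so it
    suffices that some finite set D satisfies |A D| >= (4/3) |A| for all finite A, since then |A
    D^3| >= 2 |A|. The relatively free group F of the variety is amenable, hence has, for each
    k, a finite set U with 2 |U T| < 3 |U| where T consists of its first k generators; U depends
    on k only. If G has Tarski number k and kernel H over a quotient Q in the variety, send the
    generators in T to the images in Q of the k translating elements, and pull G back along F ->
    Q: the doubling of G then embeds two copies of A * U into A D * U T with D inside H and |D|
    <= k |U|, which forces 3 |A D| >= 4 |A|. *)
Require Import Defs.
From Stdlib Require Import Reals Lra.
From HB Require Import structures.
From mathcomp Require Import all_boot finmap boolp classical_sets.
From mathcomp Require Import zify.
Set Implicit Arguments.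
Unset Strict Implicit.
Unset Printing Implicit Defensive.
Local Close Scope R_scope.
Local Open Scope fset_scope.
Local Open Scope nat_scope.

(** * Hall's marriage theorem for infinite families of finite sets *)

Section Hall.
Variables X Y : choiceType.
Implicit Types (N M : X -> {fset Y}) (A B : {fset X}).

Definition nbhd N A : {fset Y} := \bigcup_(x <- A) N x.

Lemma nbhdP N A y : reflect (exists2 x, x \in A & y \in N x) (y \in nbhd N A).
Proof.
apply: (iffP (bigfcupP _ _ _ _)) => [[x /andP[xA _] yx]|[x xA yx]];
  by exists x; rewrite ?xA.
Qed.

Definition hall_condition N := forall A, #|` A| <= #|` nbhd N A|.

(** Zorn's lemma for reverse inclusion. A chain is bounded by its pointwise intersection, which
    satisfies Hall's condition because on finitely many indices a single member of the chain already
    lies below it. *)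
Lemma hall_minimal N0 : hall_condition N0 ->
  exists N, [/\ hall_condition N, forall x, N x `<=` N0 x &
    forall M, hall_condition M -> (forall x, M x `<=` N x) -> forall x, M x = N x].
Proof.
move=> hN0.
pose T := {N | hall_condition N /\ forall x, N x `<=` N0 x}.
pose R (s t : T) := `[< forall x, sval t x `<=` sval s x >].
have [| | | |[N [hN sN]] minN] := @Zorn T R.
- by move=> s; apply/asboolP => x.
- move=> s t u /asboolP st /asboolP tu; apply/asboolP => x.
  exact: fsubset_trans (tu x) (st x).
- move=> [s Ps] [t Pt] /asboolP/= st /asboolP/= ts; apply: eq_exist.
  by apply/funext => x; apply/eqP; rewrite eqEfsubset st ts.
- move=> C totC; have [[s0 Cs0]|noC] := lem (exists s, C s); last first.
    by exists (exist _ N0 (conj hN0 (fun x => fsubset_refl _))) => s Cs; case: noC; exists s.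
  (* The sets are finite, so some member of the chain has the fewest elements at [x]; in a chain it
     is then the smallest at [x]. *)
  have /choice[m mP] x : exists s, C s /\ forall t, C t -> sval s x `<=` sval t x.
    pose P n := `[< exists2 s, C s & #|` sval s x| = n >].
    have exP : exists n, P n by exists #|` sval s0 x|; apply/asboolP; exists s0.
    case: (ex_minnP exP) => n /asboolP[s Cs sn] min_n.
    exists s; split=> // t Ct; have [/asboolP st|/asboolP/(_ x)//] := totC s t Cs Ct.
    have le_st : #|` sval s x| <= #|` sval t x|.
      by rewrite sn min_n //; apply/asboolP; exists t.
    have /eqP -> // : sval s x == sval t x.
    by rewrite eq_sym -(fsubset_leqif_cards (st x)) eqn_leq fsubset_leq_card.
  pose M x := sval (m x) x.
  have common (A : seq X) : exists2 s, C s & forall x, x \in A -> sval s x `<=` M x.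
    elim: A => [|a A [s Cs sA]]; first by exists s0.
    have [ma _] := mP a.
    have [/asboolP le|/asboolP le] := totC s (m a) Cs ma.
      exists (m a) => // x; rewrite inE => /predU1P[->//|xA].
      exact: fsubset_trans (le x) (sA x xA).
    by exists s => // x; rewrite inE => /predU1P[->|/sA//]; exact: le.
  have hM : hall_condition M.
    move=> A; have [s _ sA] := common A; apply: leq_trans ((svalP s).1 A) _.
    apply/fsubset_leq_card/fsubsetP => y /nbhdP[x xA yx].
    by apply/nbhdP; exists x => //; exact: (fsubsetP (sA x xA)).
  have sM x : M x `<=` N0 x by exact: (svalP (m x)).2.
  exists (exist _ M (conj hM sM)) => s Cs; apply/asboolP => x.
  by have [_] := mP x; exact.
- exists N; split=> // M hM sM x.
  have sM0 y : M y `<=` N0 y by exact: fsubset_trans (sM y) (sN y).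
  have RM : R (exist _ N (conj hN sN)) (exist _ M (conj hM sM0)) by apply/asboolP.
  by have /(congr1 (fun s : T => sval s x)) := minN _ RM.
Qed.

(** In a minimal family every set is a singleton, so the choice is forced, and Hall's condition on
    pairs makes it injective. *)
Theorem hall N0 : hall_condition N0 ->
  exists2 f : X -> Y, injective f & forall x, f x \in N0 x.
Proof.
move=> /hall_minimal[N [hN sN minN]].
have N1 x : exists y, y \in N x.
  have := hN [fset x]; rewrite cardfs1 cardfs_gt0 => /fset0Pn[y /nbhdP[x']].
  by rewrite inE => /eqP ->; exists y.
have uniqN x y1 y2 : y1 \in N x -> y2 \in N x -> y1 = y2.
  move=> y1x y2x; apply/eqP/negPn/negP => y12.
  pose cut y x' := if x' == x then N x' `\ y else N x'.
  (* By minimality, deleting [y] from [N x] breaks Hall's condition, on a set containing [x]. *)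
  have tight y : y \in N x -> exists2 B, x \notin B &
      #|` nbhd N B `|` (N x `\ y)| <= #|` B|.
    move=> yx; have [A ltA] : exists A, #|` nbhd (cut y) A| < #|` A|.
      apply: contrapT => nA.
      have hcut : hall_condition (cut y).
        by move=> A; rewrite leqNgt; apply/negP => ltA; apply: nA; exists A.
      have scut x' : cut y x' `<=` N x' by rewrite /cut; case: eqP; rewrite ?fsubD1set.
      by have := minN _ hcut scut x; rewrite /cut eqxx => /fsetP/(_ y); rewrite !inE eqxx yx.
    have xA : x \in A.
      apply/negPn/negP => xA; move: ltA; rewrite ltnNge => /negP; apply.
      apply: leq_trans (hN A) _; apply/fsubset_leq_card/fsubsetP => z /nbhdP[x' x'A zx'].
      by apply/nbhdP; exists x' => //; rewrite /cut; case: eqP x'A xA => // -> ->.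
    exists (A `\ x); first by rewrite !inE eqxx.
    move: ltA; rewrite (cardfsD1 x A) xA /= add1n ltnS; apply: leq_trans.
    apply/fsubset_leq_card/fsubsetP => z; rewrite in_fsetU => /orP[/nbhdP[x']|zx].
      rewrite !inE => /andP[x'x x'A] zx'.
      by apply/nbhdP; exists x'; rewrite // /cut (negPf x'x).
    by apply/nbhdP; exists x; rewrite // /cut eqxx.
  have [B1 xB1 le1] := tight _ y1x; have [B2 xB2 le2] := tight _ y2x.
  set C1 := _ `|` _ in le1; set C2 := _ `|` _ in le2.
  (* Since [y1] and [y2] differ, [C1] and [C2] together contain all of [N x]. With [leI] this gives
     |C1| + |C2| > |B1| + |B2|, against [le1] and [le2]. *)
  have leU : #|` x |` (B1 `|` B2)| <= #|` C1 `|` C2|.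
    apply: leq_trans (hN _) _; apply/fsubset_leq_card/fsubsetP => z /nbhdP[x'].
    rewrite !in_fsetU in_fset1 => /orP[/eqP->{x'} zx|/orP[] x'B zx'].
    - have [->|zy1] := eqVneq z y1.
        by apply/orP; right; rewrite !inE y12 y1x orbT.
      by apply/orP; left; rewrite !inE zy1 zx orbT.
    - by apply/orP; left; apply/orP; left; apply/nbhdP; exists x'.
    - by apply/orP; right; apply/orP; left; apply/nbhdP; exists x'.
  have leI : #|` B1 `&` B2| <= #|` C1 `&` C2|.
    apply: leq_trans (hN _) _; apply/fsubset_leq_card/fsubsetP => z /nbhdP[x'].
    rewrite in_fsetI => /andP[x'1 x'2] zx'; rewrite in_fsetI !in_fsetU.
    by apply/andP; split; apply/orP; left; apply/nbhdP; exists x'.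
  move: leU; rewrite cardfsU1 in_fsetU negb_or xB1 xB2 /=.
  have := cardfsUI C1 C2; have := cardfsUI B1 B2; lia.
have [f fN] := choice N1; exists f => [x x' fx|x]; last exact: (fsubsetP (sN x)).
apply/eqP/negPn/negP => xx'; have := hN [fset x; x']; rewrite cardfs2 xx' /=.
suff: nbhd N [fset x; x'] `<=` [fset f x] by move/fsubset_leq_card; rewrite cardfs1; lia.
apply/fsubsetP => y /nbhdP[z]; rewrite !inE => /orP[]/eqP-> yz; apply/eqP.
  exact: uniqN (fN x).
by rewrite fx; exact: uniqN (fN x').
Qed.

End Hall.

(** * Product sets in a group and their growth *)

Lemma cardfsM (K L : choiceType) (A : {fset K}) (B : {fset L}) :
  #|` A `*` B| = #|` A| * #|` B|.
Proof.
have -> : A `*` B = [fset p in [seq (a, b) | a <- A, b <- B]].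
  apply/fsetP => -[a b]; rewrite in_fsetM inE; apply/andP/allpairsP => /=.
    by move=> [aA bB]; exists (a, b).
  by move=> [[a' b'] /= [aA bB [-> ->]]].
rewrite card_fseq undup_id ?size_allpairs // allpairs_uniq ?fset_uniq //.
by move=> [a b] [a' b'].
Qed.

HB.instance Definition _ (G : group) := gen_eqMixin (carrier G).
HB.instance Definition _ (G : group) := gen_choiceMixin (carrier G).

Section Groups.
Variable G : group.
Implicit Types (x y z : G) (A B T : {fset G}).

Lemma gmulK x y : gmul (gmul x y) (ginv y) = x.
Proof. by rewrite gmulA gmulVr gmulr1. Qed.

Lemma gmulIr x y z : gmul y x = gmul z x -> y = z.
Proof. by move=> /(congr1 (gmul^~ (ginv x))); rewrite !gmulK. Qed.

Definition mulfs A B : {fset G} := [fset x in [seq gmul a b | a <- A, b <- B]].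

Lemma mulfsP A B z :
  reflect (exists a b, [/\ a \in A, b \in B & z = gmul a b]) (z \in mulfs A B).
Proof.
by rewrite inE; exact: allpairsPdep.
Qed.

Lemma mulfsA A B T : mulfs (mulfs A B) T = mulfs A (mulfs B T).
Proof.
apply/fsetP => z; apply/mulfsP/mulfsP.
  move=> [_ [t [/mulfsP[a [b [aA bB ->]]] tT ->]]]; rewrite gmulA.
  by exists a, (gmul b t); split=> //; apply/mulfsP; exists b, t.
move=> [a [_ [aA /mulfsP[b [t [bB tT ->]]] ->]]]; rewrite -gmulA.
by exists (gmul a b), t; split=> //; apply/mulfsP; exists a, b.
Qed.

Lemma leq_card_mulfs A B : #|` mulfs A B| <= #|` A| * #|` B|.
Proof. by rewrite card_fseq (leq_trans (size_undup _)) // size_allpairs. Qed.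

Fixpoint expfs T n : {fset G} := if n is n'.+1 then mulfs T (expfs T n') else [fset gone].

Lemma leq_card_expfs T n : #|` expfs T n| <= #|` T| ^ n.
Proof.
elim: n => [|n IHn] /=; first by rewrite cardfs1.
by rewrite expnS (leq_trans (leq_card_mulfs _ _)) // leq_mul2l IHn orbT.
Qed.

Lemma growth_expfs T p q n : (forall A, p * #|` A| <= q * #|` mulfs A T|) ->
  forall A, p ^ n * #|` A| <= q ^ n * #|` mulfs A (expfs T n)|.
Proof.
move=> growT; elim: n => [|n IHn] A /=.
  rewrite !mul1n; apply/fsubset_leq_card/fsubsetP => a aA.
  by apply/mulfsP; exists a, gone; rewrite inE gmulr1.
rewrite -mulfsA !expnS [p * _]mulnC [q * _]mulnC -!mulnA.
apply: leq_trans (leq_mul (leqnn _) (growT A)) _.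
by rewrite mulnCA [q ^ n * _]mulnCA leq_mul.
Qed.

(** * Doublings and paradoxical decompositions *)

(* [c p < N] says which of N translating elements moves [p]; the boolean component separates the
   pieces P_i from the Q_j. *)
Definition doubling (s : nat -> G) (c : G * bool -> nat) :=
  injective (fun p : G * bool => gmul p.1 (s (c p))).

(** The points of copy [b] moved by [s i] land in the piece [P b i]; translating back by the inverse
    of [s i] recovers the whole copy. *)
Lemma doubling_paradoxical N s c : 0 < N -> (forall p, c p < N) -> doubling s c ->
  paradoxical_with G (N + N).
Proof.
move=> N0 cN dbl; pose P b i x := exists y, c (y, b) = i /\ x = gmul y (s i).
exists N, N, (P true), (P false), (fun i => ginv (s i)), (fun i => ginv (s i)).
have PP b b' i i' x : P b i x -> P b' i' x -> (b, i) = (b', i').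
  move=> [y [<- ->]] [y' [<-]] E.
  by have [-> ->] := dbl (y, b) (y', b') E.
have cover b x : exists i, (i < N)%coq_nat /\ rtrans G (P b i) (ginv (s i)) x.
  exists (c (x, b)); split; first exact/ltP.
  by exists (gmul x (s (c (x, b)))); split; [exists x | rewrite gmulK].
do ![split=> //]; try exact/ltP.
- by move=> i i' x _ _ ii' Px /(PP _ _ _ _ _ Px)[].
- by move=> i i' x _ _ ii' Px /(PP _ _ _ _ _ Px)[].
- by move=> i j x _ _ Px /(PP _ _ _ _ _ Px)[].
Qed.

Lemma paradoxical_doubling N : paradoxical_with G N ->
  exists (s : nat -> G) (c : G * bool -> nat), (forall p, c p < N) /\ doubling s c.
Proof.
move=> [m [n [P [Q [g [h [_ [_ [<- [dP [dQ [dPQ [cP cQ]]]]]]]]]]]]].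
pose s i := if i < m then ginv (g i) else ginv (h (i - m)).
have /choice[c cc] p : exists i, i < m + n /\
    if p.2 then i < m /\ P i (gmul p.1 (s i))
    else m <= i /\ Q (i - m) (gmul p.1 (s i)).
  case: p => x [] /=.
    have [i [/ltP im [a [Pa ->]]]] := cP x.
    by exists i; rewrite /s im gmulK ltn_addr.
  have [j [/ltP jn [a [Qa ->]]]] := cQ x.
  exists (m + j); rewrite /s ltn_add2l jn leq_addr.
  by rewrite ltnNge leq_addr /= addKn gmulK.
exists s, c; split=> [p|]; first by case: (cc p).
move=> [x b] [x' b'] /= E; case: (cc (x, b)) (cc (x', b')) => [].
move: (c (x, b)) (c (x', b')) E => i i' E lti ci [] lti' ci'.
(* The pieces are disjoint, so a common image determines both the copy and the translating element,
   which can then be cancelled. *)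
have {E} : (b, i) = (b', i') /\ gmul x (s i) = gmul x' (s i').
  split=> //; move: ci ci' => /=; case: b; case: b' => -[mi Pi] [mi' Pi'].
  - congr pair; apply: contrapT => ii'.
    by apply: (dP i i' (gmul x (s i))) => //; try exact/ltP; rewrite ?E.
  - case: (dPQ i (i' - m) (gmul x (s i))) => //; try exact/ltP; rewrite ?E //.
    by apply/ltP; lia.
  - case: (dPQ i' (i - m) (gmul x (s i))) => //; try exact/ltP; rewrite ?E //.
    by apply/ltP; lia.
  - congr pair; apply: contrapT => ii'.
    apply: (dQ (i - m) (i' - m) (gmul x (s i))) => //; rewrite ?E //; try (apply/ltP; lia).
    by lia.
by move=> [[-> ->] /gmulIr ->].
Qed.

(** After [n] steps sets grow by (p/q)^n >= 2, so the family sending [(x, b)] to x D satisfies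
    Hall's condition; its matching is a doubling that uses |D| translations. *)
Lemma growth_paradoxical T p q n : 2 * q ^ n <= p ^ n -> 0 < q ->
  (forall A, p * #|` A| <= q * #|` mulfs A T|) ->
  exists2 N, paradoxical_with G N & N <= 2 * #|` T| ^ n.
Proof.
move=> pq q0 growT; have := growth_expfs n growT; set D := expfs T n => growD.
have /hall[f f_inj fD] : hall_condition (fun p : G * bool => mulfs [fset p.1] D).
  move=> A; pose A1 := [fset p.1 | p in A].
  have leA : #|` A| <= 2 * #|` A1|.
    have -> : 2 * #|` A1| = #|` A1 `*` [fset true; false]|.
      by rewrite cardfsM cardfs2 mulnC.
    apply/fsubset_leq_card/fsubsetP => -[x b] xbA; rewrite in_fsetM !inE /=.
    by apply/andP; split; [apply/imfsetP; exists (x, b) | case: (b)].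
  apply: leq_trans leA _; rewrite -(leq_pmul2l (_ : 0 < q ^ n)) ?expn_gt0 ?q0 //.
  rewrite mulnA [q ^ n * 2]mulnC; apply: leq_trans (leq_mul pq (leqnn _)) _.
  apply: leq_trans (growD A1) _; rewrite leq_mul2l; apply/orP; right.
  apply/fsubset_leq_card/fsubsetP => z /mulfsP[_ [d [/imfsetP[p' /= pA ->] dD ->]]].
  by apply/nbhdP; exists p' => //; apply/mulfsP; exists p'.1, d; rewrite inE.
have D0 : 0 < #|` D|.
  rewrite cardfs_gt0; apply/fset0Pn; have /mulfsP[a [d [_ dD _]]] := fD (gone, true).
  by exists d.
exists (#|` D| + #|` D|); last by have := leq_card_expfs T n; rewrite -/D; lia.
have /choice[c cP] p' : exists i, i < #|` D| /\ f p' = gmul p'.1 (nth gone D i).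
  have /mulfsP[a [d [/fset1P-> dD ->]]] := fD p'.
  by exists (index d D); rewrite index_mem dD nth_index.
apply: (@doubling_paradoxical _ (nth gone D) c) => // [p'|x y E]; first by case: (cP p').
by apply: f_inj; rewrite (cP x).2 (cP y).2.
Qed.


(** * Invariant means and Følner sets *)

Lemma paradoxical_not_amenable N : paradoxical_with G N -> ~ amenable G.
Proof.
move=> [m [n [P [Q [g [h [_ [_ [_ [dP [dQ [dPQ [cP cQ]]]]]]]]]]]]].
move=> [mu [mu1 [mu0 [muU muT]]]].
pose U (P : nat -> G -> Prop) m x := exists i, (i < m)%coq_nat /\ P i x.
have mono (A B : G -> Prop) : (forall x, A x -> B x) -> Rle (mu A) (mu B).
  move=> AB; have -> : B = fun x => A x \/ (B x /\ ~ A x).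
    apply/funext => x; apply/propext; split=> [Bx|[/AB|[]] //].
    by case: (lem (A x)); [left | right].
  rewrite muU; last by move=> x Ax [].
  have := mu0 (fun x => B x /\ ~ A x); lra.
have sub (A B : G -> Prop) : Rle (mu (fun x => A x \/ B x)) (Rplus (mu A) (mu B)).
  have -> : (fun x => A x \/ B x) = fun x => A x \/ (B x /\ ~ A x).
    apply/funext => x; apply/propext; split=> [|[|[]]]; [|by left|by right].
    by move=> [Ax|Bx]; [left|case: (lem (A x)); [left | right]].
  rewrite muU; last by move=> x Ax [].
  have := mono (fun x => B x /\ ~ A x) B (fun x => @proj1 _ _); lra.
have US P' k : U P' k.+1 = fun x => U P' k x \/ P' k x.
  apply/funext => x; apply/propext; split=> [[i [ik Pi]]|[[i [ik Pi]]|Pk]].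
  - have [ik'|ik'] := eqVneq i k; first by right; rewrite -ik'.
    by left; exists i; split=> //; lia.
  - by exists i; split=> //; lia.
  - by exists k; split=> //; lia.
(* Disjoint pieces add up exactly, while their translates, which may overlap, are only
   subadditive. *)
have trans P' g' k : (forall i i' x, (i < k)%coq_nat -> (i' < k)%coq_nat ->
      i <> i' -> P' i x -> P' i' x -> False) ->
    Rle (mu (U (fun i => rtrans G (P' i) (g' i)) k)) (mu (U P' k)).
  elim: k => [|k IHk] dis; first by apply: mono => x [i []]; lia.
  rewrite !US [X in Rle _ X]muU; last first.
    by move=> x [i [ik Pi]]; apply: (dis i k) => //; lia.
  have := sub (U (fun i => rtrans G (P' i) (g' i)) k) (rtrans G (P' k) (g' k)).
  rewrite muT; have := IHk (fun i i' x li li' => dis i i' x (le_S _ _ li) (le_S _ _ li')).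
  by lra.
have full P' g' k : (forall x, exists i, (i < k)%coq_nat /\ rtrans G (P' i) (g' i) x) ->
    mu (U (fun i => rtrans G (P' i) (g' i)) k) = mu (fun _ => True).
  move=> cov; congr mu; apply/funext => x; apply/propext.
  by split=> // _; exact: cov.
(* Both families have translates covering the group, so their disjoint unions would have measure at
   least 1 + 1 inside measure 1. *)
have := mono (fun x => U P m x \/ U Q n x) (fun _ => True) (fun _ _ => I).
rewrite muU; last by move=> x [i [im Pi]] [j [jn Qj]]; apply: (dPQ i j x).
have := trans P g m dP; have := trans Q h n dQ; rewrite !full //.
by rewrite mu1; lra.
Qed.

(** Otherwise [T] makes every finite set grow by 3/2, and (3/2)^2 >= 2 yields a paradoxical
    decomposition. *)
Lemma folner T : amenable G -> exists U : {fset G}, 2 * #|` mulfs U T| < 3 * #|` U|.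
Proof.
move=> am; apply: contrapT => noU.
have growT A : 3 * #|` A| <= 2 * #|` mulfs A T|.
  by rewrite leqNgt; apply/negP => ltA; apply: noU; exists A.
have [N parN _] := @growth_paradoxical T 3 2 2 isT isT growT.
exact: paradoxical_not_amenable parN am.
Qed.

End Groups.

(** * The relatively free group of countable rank *)

Section RelativelyFree.
Variable V : variety.
HB.instance Definition _ := gen_eqMixin word.
HB.instance Definition _ := gen_choiceMixin word.

(** Defined by evaluation rather than by derivation from the laws, so that each group axiom of the
    quotient is checked inside the groups of [V]. *)
Definition eqlaw (u v : word) := `[< forall K, in_variety V K ->
  forall s : nat -> K, eval K s u = eval K s v >].

Lemma eqlaw_refl : reflexive eqlaw.
Proof. by move=> u; apply/asboolP. Qed.

Lemma eqlaw_sym : symmetric eqlaw.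
Proof.
by move=> u v; apply/asboolP/asboolP => uv K VK s; rewrite uv.
Qed.

Lemma eqlaw_trans : transitive eqlaw.
Proof.
move=> v u w /asboolP uv /asboolP vw; apply/asboolP => K VK s.
by rewrite uv // vw.
Qed.

Canonical eqlaw_equiv := EquivRel eqlaw eqlaw_refl eqlaw_sym eqlaw_trans.

Local Open Scope quotient_scope.
Definition relfree := {eq_quot eqlaw}.

Lemma eval_repr (w : word) (K : group) (s : nat -> K) : in_variety V K ->
  eval K s (repr (\pi_relfree w)) = eval K s w.
Proof.
have /eqmodP/asboolP := reprK (\pi_relfree w).
by move=> E VK; exact: E.
Qed.

Lemma eq_relfree (u v : word) : (forall K, in_variety V K ->
  forall s : nat -> K, eval K s u = eval K s v) -> \pi_relfree u = \pi_relfree v.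
Proof. by move=> uv; apply/eqmodP/asboolP. Qed.

Definition relfree_mul (a b : relfree) : relfree := \pi_relfree (WMul (repr a) (repr b)).
Definition relfree_inv (a : relfree) : relfree := \pi_relfree (WInv (repr a)).

Definition relfree_group : group.
Proof.
refine (@Defs.Group relfree relfree_mul (\pi_relfree WOne) relfree_inv _ _ _).
- by move=> a b c; apply: eq_relfree => K VK s /=; rewrite !eval_repr //= gmulA.
- by move=> a; rewrite -[RHS]reprK; apply: eq_relfree => K VK s /=; rewrite !eval_repr //= gmul1.
- by move=> a; apply: eq_relfree => K VK s /=; rewrite !eval_repr //= gmulV.
Defined.

Fixpoint subst (r : nat -> word) (w : word) : word :=
  match w with
  | WVar n => r n
  | WOne => WOne
  | WMul u v => WMul (subst r u) (subst r v)
  | WInv u => WInv (subst r u)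
  end.

Lemma eval_subst (K : group) (s : nat -> K) r w :
  eval K s (subst r w) = eval K (fun n => eval K s (r n)) w.
Proof. by elim: w => //= [u -> v ->|u ->]. Qed.

(** Evaluating a law at classes gives the class of a substitution instance, which is again trivial
    throughout [V]. *)
Lemma in_variety_relfree : in_variety V relfree_group.
Proof.
move=> w Vw s.
have -> : eval relfree_group s w = \pi_relfree (subst (fun n => repr (s n)) w).
  elim: w {Vw} => //= [n|u -> v ->|u ->].
  - by rewrite reprK.
  - by apply: eq_relfree => K VK t /=; rewrite !eval_repr.
  - by apply: eq_relfree => K VK t /=; rewrite !eval_repr.
by apply: eq_relfree => K VK t; rewrite eval_subst VK.
Qed.

End RelativelyFree.

(** * Transfer of growth to the kernel, and the bound *)

(* The fibre product of [G] and [F] over [Q] is an extension of [F] by [K], and [tau] plays the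
   role of a section of it. Rewriting [a tau(u) s_i] as [a' tau(u x_i)] turns a doubling of [G]
   into an injection of two copies of [A * U] into [A D * U T]. *)
Lemma extension_growth (K G Q F : group) (incl : K -> G) (phi : G -> Q) k
    (s : nat -> G) (c : G * bool -> nat) (x : nat -> F) (tau : F -> G) (U : {fset F})
    (T := [fset x i | i in iota 0 k]) :
  is_hom K G incl -> injective incl -> is_hom G Q phi ->
  (forall g, phi g = gone -> exists a, incl a = g) ->
  (forall p, c p < k) -> doubling s c ->
  (forall u i, phi (tau (gmul u (x i))) = gmul (phi (tau u)) (phi (s i))) ->
  exists2 D : {fset K}, #|` D| <= #|` U| * k &
    forall A, 2 * (#|` A| * #|` U|) <= #|` mulfs A D| * #|` mulfs U T|.
Proof.
move=> hincl incl_inj hphi exact_phi ck dbl tauM.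
(* By [tauM] this element, the failure of [tau] to carry [x i] to [s i], is killed by [phi]. *)
have /choice[d dE] (p : F * nat) : exists a, incl a =
    gmul (gmul (tau p.1) (s p.2)) (ginv (tau (gmul p.1 (x p.2)))).
  by apply: exact_phi; rewrite !hphi (hom_inv _ _ _ hphi) tauM gmulVr.
pose D := [fset y in [seq d (u, i) | u <- U, i <- iota 0 k]].
exists D => [|A].
  by rewrite card_fseq (leq_trans (size_undup _)) // size_allpairs size_iota.
have -> : 2 * (#|` A| * #|` U|) = #|` (A `*` U) `*` [fset true; false]|.
  by rewrite !cardfsM cardfs2 mulnC.
pose idx p := c (gmul (incl p.1.1) (tau p.1.2), p.2).
(* With i the index given by [idx], a tau(u) s_i = (a d(u,i)) tau(u x_i), so equal values of [j]
   give equal images under the doubling. *)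
pose j p := (gmul p.1.1 (d (p.1.2, idx p)), gmul p.1.2 (x (idx p))).
have j_inj : injective j.
  move=> [[a u] b] [[a' u'] b'] [/(congr1 incl)]; rewrite !hincl !dE /=.
  move=> E1 E2; move: E1; rewrite E2 -!gmulA => /gmulIr E1.
  have [Eg Eb] := dbl (gmul (incl a) (tau u), b) (gmul (incl a') (tau u'), b') E1.
  have Ei : idx (a, u, b) = idx (a', u', b') by rewrite /idx /= Eg Eb.
  have Eu : u = u' by move: E2; rewrite Ei => /gmulIr.
  by move: Eg; rewrite Eu Eb => /gmulIr /incl_inj ->.
set S := _ `*` _; have <- : #|` j @` S| = #|` S| by rewrite card_imfset.
rewrite -cardfsM.
apply/fsubset_leq_card/fsubsetP => z /imfsetP[[[a u] b] /= abu ->{z}].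
move: abu; rewrite !in_fsetM /= => /andP[/andP[aA uU] _].
have i_k : idx (a, u, b) \in iota 0 k by rewrite mem_iota ck.
apply/andP; split; apply/mulfsP => /=.
  exists a, (d (u, idx (a, u, b))); split=> //.
  by rewrite inE; apply/allpairsPdep; exists u, (idx (a, u, b)).
exists u, (x (idx (a, u, b))); split=> //.
by apply/imfsetP; exists (idx (a, u, b)).
Qed.

Theorem theorem1 (V : variety)
  (hamen : forall G : group, in_variety V G -> amenable G)
  (hord : forall F : group, relatively_free V F -> right_orderable F) :
  exists f : nat -> nat,
    forall (G Q : group) (phi : G -> Q) (hphi : is_hom G Q phi),
      (forall q : Q, exists x : G, phi x = q) ->
      in_variety V Q ->
      ~ amenable G ->
      forall k, tarski_number G k ->
        exists k', tarski_number (ker_group G Q phi hphi) k' /\ (k' <= f k)%coq_nat.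
Proof.
pose F := relfree_group V; pose x i : F := \pi_(relfree V)%qT (WVar i).
have /choice[U ltU] k := folner [fset x i | i in iota 0 k] (hamen _ (@in_variety_relfree V)).
(* Here |D| <= |U k| k, and the exponent is 3 because (4/3)^3 >= 2. *)
exists (fun k => 2 * (#|` U k| * k) ^ 3) => G Q phi hphi _ VQ _ k [parG _].
have [s [c [ck dbl]]] := paradoxical_doubling parG.
have phi_eval w : phi (eval G s w) = eval Q (phi \o s) w.
  elim: w => //= [|u <- v <-|u <-]; [exact: hom_one|exact: hphi|exact: hom_inv].
(* [tau] evaluates a representative word at the translating elements; its image in [Q] is
   independent of the representative because [Q] lies in [V]. *)
have [||g g1||D leD growD] := @extension_growth (ker_group G Q phi hphi) G Q F
  (@proj1_sig _ _) phi k s c x (fun u => eval G s (repr u)) (U k) _ _ hphi _ ck dbl.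
- by [].
- by move=> a b /ker_eq.
- by exists (exist _ g g1).
- by move=> u i; rewrite !phi_eval eval_repr //= eval_repr.
have [||A|N parN leN] := @growth_paradoxical _ D 4 3 3.
- by [].
- by [].
- have U0 : 0 < #|` U k| by have := ltU k; case: #|` U k|.
  (* 4|A||U| <= 2|AD||UT| <= 3|AD||U|, and |U| > 0 is cancelled. *)
  rewrite -(leq_pmul2r U0) -mulnA -[4]/(2 * 2) -mulnA.
  have := leq_mul (leqnn 2) (growD A); have := leq_mul (leqnn #|` mulfs A D|) (ltnW (ltU k)).
  lia.
pose P n := `[< paradoxical_with (ker_group G Q phi hphi) n >].
have exP : exists n, P n by exists N; apply/asboolP.
case: (ex_minnP exP) => k' /asboolP park' mink'; exists k'; split.
  by split=> // n parn; apply/leP/mink'/asboolP.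
apply/leP; apply: leq_trans (mink' N _) _; first exact/asboolP.
apply: leq_trans leN _; rewrite leq_mul2l /=.
by rewrite leq_exp2r.
Qed.
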